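(* Let $q$ be a prime power, $k,t$ positive integers, $r$ a non-negative integer, and let $f:\mathbb{F}_q^k\to \mathrm{Im}(f)$ be a function. If there exists an $(f,t)$-FCC of redundancy $r$, then $$ r \ge k-\log_q\big(\alpha(\mathcal{G}_f(t,k,0))\big),$$ where $\alpha$ denotes the independence number of a graph.
   Context: $d_H$ is Hamming distance. For a function $f$ on $\mathbb{F}_q^k$, an $(f,t)$-FCC (function-correcting code) of redundancy $r$ is a systematic encoding $\mathfrak{E}:\mathbb{F}_q^k\to\mathbb{F}_q^{k+r}$, $\mathfrak{E}(\mathbf{u})=(\mathbf{u},\mathbf{p}(\mathbf{u}))$ with $\mathbf{p}(\mathbf{u})\in\mathbb{F}_q^r$, such that $d_H(\mathfrak{E}(\mathbf{u}),\mathfrak{E}(\mathbf{u}'))\ge 2t+1$ whenever $f(\mathbf{u})\ne f(\mathbf{u}')$. The graph $\mathcal{G}_f(t,k,r)$ is the simple graph with vertex set $\mathbb{F}_q^k\times\mathbb{F}_q^r$ in which two distinct vertices $\mathbf{v}_i=(\mathbf{u}_i,\mathbf{r}_i)$, $\mathbf{v}_j=(\mathbf{u}_j,\mathbf{r}_j)$ are adjacent iff either $\mathbf{u}_i=\mathbf{u}_j$, or $f(\mathbf{u}_i)\neq f(\mathbf{u}_j)$ and $d_H(\mathbf{v}_i,\mathbf{v}_j)<2t+1$. In particular $\mathcal{G}_f(t,k,0)$ has vertex set $\mathbb{F}_q^k$, with $\mathbf{x}_1,\mathbf{x}_2$ adjacent iff $f(\mathbf{x}_1)\ne f(\mathbf{x}_2)$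 and $d_H(\mathbf{x}_1,\mathbf{x}_2)<2t+1$. *)

(* Defs.v *)
From HB Require Import structures.
From mathcomp Require Import all_boot all_order all_algebra.
From mathcomp Require Import reals exp.

Set Implicit Arguments.
Unset Strict Implicit.
Unset Printing Implicit Defensive.

Import Order.TTheory GRing.Theory Num.Theory.
Local Open Scope ring_scope.

Record sgraph := SGraph {
  svertex :> finType;
  sadj : rel svertex;
  sadj_sym : symmetric sadj;
  sadj_irrefl : irreflexive sadj }.

Definition independent (G : sgraph) (S : {set G}) : bool :=
  [forall x in S, forall y in S, ~~ sadj x y].

Definition indep_number (G : sgraph) : nat :=
  (\max_(S : {set G} | independent S) #|S|)%N.

Definition logr (R : realType) (b x : R) : R := ln x / ln b.

Section FunctionCorrectingCodes.

(* The finite field F plays the role of F_q, with q = #|F|. The codomain T of f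
   is arbitrary: only equality of values of f matters. *)
Variables (F : finFieldType) (T : eqType).

Definition hamming (n : nat) (x y : 'rV[F]_n) : nat :=
  #|[set i : 'I_n | x 0 i != y 0 i]|.

Lemma hammingC (n : nat) (x y : 'rV[F]_n) : hamming x y = hamming y x.
Proof. by apply: eq_card => i; rewrite !inE eq_sym. Qed.

Variable k : nat.

Definition is_FCC (f : 'rV[F]_k -> T) (t r : nat)
    (E : 'rV[F]_k -> 'rV[F]_(k + r)) : Prop :=
  (exists p : 'rV[F]_k -> 'rV[F]_r, forall u, E u = row_mx u (p u)) /\
  (forall u u', f u != f u' -> (2 * t + 1 <= hamming (E u) (E u'))%N).

Section Graph.
Variables (f : 'rV[F]_k -> T) (t r : nat).

Definition FCC_adj (v w : 'rV[F]_k * 'rV[F]_r) : bool :=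
  (v != w) &&
  ((v.1 == w.1) ||
   (f v.1 != f w.1) &&
   (hamming (row_mx v.1 v.2) (row_mx w.1 w.2) < 2 * t + 1)%N).

Lemma FCC_adj_sym : symmetric FCC_adj.
Proof.
move=> v w; rewrite /FCC_adj hammingC.
by rewrite (eq_sym v) (eq_sym v.1) (eq_sym (f v.1)).
Qed.

Lemma FCC_adj_irrefl : irreflexive FCC_adj.
Proof. by move=> v; rewrite /FCC_adj eqxx. Qed.

Definition FCC_graph : sgraph := SGraph FCC_adj_sym FCC_adj_irrefl.

End Graph.

(* For r = 0 the second component is the unique vector of 'rV_0, so the
   vertex set is F^k up to the bijection x |-> (x, 0). *)
Lemma FCC_graph0_adjE (f : 'rV[F]_k -> T) (t : nat) (x y : 'rV[F]_k) :
  sadj ((x, 0) : FCC_graph f t 0) ((y, 0) : FCC_graph f t 0) =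
  (f x != f y) && (hamming x y < 2 * t + 1)%N.
Proof.
rewrite /= /FCC_adj /=.
have -> : hamming (row_mx x (0 : 'rV_0)) (row_mx y 0) = hamming x y.
  rewrite /hamming -(card_imset _ (@lshift_inj k 0)).
  apply: eq_card => i; rewrite inE; case: (split_ordP i) => [j ->|[]//].
  by rewrite !row_mxEl (mem_imset _ _ (@lshift_inj k 0)) inE.
rewrite xpair_eqE eqxx andbT.
by have [->|] := eqVneq x y; rewrite /= ?eqxx.
Qed.

End FunctionCorrectingCodes.

(* Main.v *)
(* In an FCC, messages sharing the same redundancy vector are separated by
   their systematic parts alone, so each of the q^r fibres of the redundancy map
   is independent in the graph for r = 0; hence q^k <= q^r * alpha. *)
Require Import Defs.
From mathcomp Require Import all_boot all_order all_algebra.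
From mathcomp Require Import reals exp.

Set Implicit Arguments.
Unset Strict Implicit.
Unset Printing Implicit Defensive.

Import Order.TTheory GRing.Theory Num.Theory.
Local Open Scope ring_scope.

Lemma card_le_indep_number (G : sgraph) (S : {set G}) :
  independent S -> (#|S| <= indep_number G)%N.
Proof. exact: (@leq_bigmax_cond _ _ (fun A : {set G} => #|A|)). Qed.

(** The common block [z] contributes no differing coordinate, so the differing positions are the
    images under the injection [lshift] of those of [x] and [y]. *)
Lemma hamming_row_mxl (F : finFieldType) (k r : nat) (x y : 'rV[F]_k)
    (z : 'rV[F]_r) :
  hamming (row_mx x z) (row_mx y z) = hamming x y.
Proof.
rewrite /hamming -(card_imset _ (@lshift_inj k r)).
apply: eq_card => i; rewrite inE; case: (split_ordP i) => j ->.
  by rewrite !row_mxEl (mem_imset _ _ (@lshift_inj k r)) inE.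
rewrite !row_mxEr eqxx; apply/esym/imsetP => -[l _ /eqP].
by rewrite eq_rlshift.
Qed.

(** The fibres of [p] partition [aT] into at most [#|rT|] classes. *)
Lemma card_fiber_le (aT rT : finType) (p : aT -> rT) (m : nat) :
  (forall c, #|[set u | p u == c]| <= m)%N -> (#|aT| <= #|rT| * m)%N.
Proof.
move=> le_m; rewrite -sum1_card (partition_big p predT) //=.
rewrite -sum_nat_const; apply: leq_sum => c _.
by rewrite sum1dep_card le_m.
Qed.

Lemma FCC_fiber_independent (F : finFieldType) (T : eqType) (k t r : nat)
    (f : 'rV[F]_k -> T) (p : 'rV[F]_k -> 'rV[F]_r) (c : 'rV[F]_r) :
  is_FCC f t (fun u => row_mx u (p u)) ->
  @independent (FCC_graph f t 0) [set (u, 0) | u in [set u | p u == c]].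
Proof.
case=> _ distE; apply/forall_inP => _ /imsetP[u + ->]; rewrite inE => /eqP pu.
apply/forall_inP => _ /imsetP[v + ->]; rewrite inE => /eqP pv.
(* Non-adjacency becomes the FCC distance condition on [u] and [v], once the shared redundancy [c]
   is cancelled. *)
rewrite FCC_graph0_adjE negb_and -leqNgt -implybE; apply/implyP => /distE.
by rewrite pu pv hamming_row_mxl.
Qed.

Lemma FCC_card_le (F : finFieldType) (T : eqType) (k t r : nat)
    (f : 'rV[F]_k -> T) (E : 'rV[F]_k -> 'rV[F]_(k + r)) :
  is_FCC f t E -> (#|F| ^ k <= #|F| ^ r * indep_number (FCC_graph f t 0))%N.
Proof.
case=> -[p Ep] distE.
(* [E] agrees with this map only pointwise, so the FCC property is transferred to the explicit
   form. *)
have fccp : is_FCC f t (fun u => row_mx u (p u)).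
  by split=> [|u v /distE]; [exists p | rewrite !Ep].
have := @card_fiber_le _ _ p (indep_number (FCC_graph f t 0)).
rewrite !card_mx !mul1n; apply=> c.
(* The injection [u |-> (u, 0)] carries the fibre over [c] to a vertex set of the same size. *)
rewrite -(card_imset _ (f := fun u => (u, 0 : 'rV[F]_0))); last by move=> u v [].
exact: card_le_indep_number (FCC_fiber_independent c fccp).
Qed.

Theorem theorem6 (R : realType) (F : finFieldType) (T : eqType) (k t r : nat)
    (hk : (0 < k)%N) (ht : (0 < t)%N) (f : 'rV[F]_k -> T) :
  (exists E : 'rV[F]_k -> 'rV[F]_(k + r), is_FCC f t E) ->
  (r%:R : R) >=
    k%:R - logr (#|F|%:R) ((indep_number (FCC_graph f t 0))%:R).
Proof.
case=> E /FCC_card_le; set a := indep_number _ => le_card.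
have q_gt1 : (1 < #|F|)%N := card_finNzRing_gt1 F.
have q_gt0 : (0 < #|F|)%N := ltnW q_gt1.
(* Positivity of [a], which the logarithm laws require, is forced by [0 < q^k <= q^r * a]. *)
have a_gt0 : (0 < a)%N.
  have : (0 < #|F| ^ r * a)%N by apply: leq_trans le_card; rewrite expn_gt0 q_gt0.
  by rewrite muln_gt0 => /andP[].
have lnq_gt0 : 0 < ln #|F|%:R :> R by rewrite ln_gt0 // ltr1n.
(* Multiplying by [ln q > 0] leaves [k * ln q <= r * ln q + ln a], the logarithm of the counting
   bound. *)
rewrite /logr lerBlDr -(ler_pM2r lnq_gt0) mulrDl divfK ?gt_eqF //.
rewrite !mulr_natl -!lnXn ?ltr0n //.
rewrite -lnM ?posrE ?exprn_gt0 ?ltr0n //.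
by rewrite ler_ln ?posrE ?mulr_gt0 ?exprn_gt0 ?ltr0n // -!natrX -natrM ler_nat.
Qed.
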